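(* Let $P$ be the Borel probability measure on $\mathbb{R}$ with $P(\{k\})=2^{-k}$ for every $k\in\mathbb{N}=\{1,2,3,\dots\}$. The sets $\{1,Av[2,3],Av[4,\infty)\}$ and $\{Av[1,2],Av[3,4],Av[5,\infty)\}$ form two different optimal sets of three-means for $P$, with quantization error $V_3(P)=\frac13$.
   Context: For a Borel probability measure $P$ on $\mathbb{R}$ and a nonempty finite set $\alpha\subset\mathbb{R}$, the distortion error is $V(P;\alpha)=\int\min_{a\in\alpha}|x-a|^2\,dP(x)$. The $n$th quantization error is $V_n(P)=\inf\{V(P;\alpha):\alpha\subset\mathbb{R},\ 1\le\mathrm{card}(\alpha)\le n\}$, and a set $\alpha$ with $1\le\mathrm{card}(\alpha)\le n$ attaining this infimum is called an optimal set of $n$-means for $P$. For integers $1\le k\le\ell$ put $Av[k,\ell]=\dfrac{\sum_{j=k}^{\ell}j2^{-j}}{\sum_{j=k}^{\ell}2^{-j}}$ and $Av[k,\infty)=\dfrac{\sum_{j=k}^{\infty}j2^{-j}}{\sum_{j=k}^{\infty}2^{-j}}$. *)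

(* Defs.v *)
From HB Require Import structures.
From mathcomp Require Import all_boot all_order all_algebra.
From mathcomp Require Import finmap.
From mathcomp Require Import all_classical all_reals all_analysis.

Set Implicit Arguments.
Unset Strict Implicit.
Unset Printing Implicit Defensive.

Import Order.TTheory GRing.Theory Num.Theory numFieldNormedType.Exports.

Local Open Scope classical_set_scope.
Local Open Scope ring_scope.

(* measurableTypeR R carries the sigma-algebra generated by the half-open
   intervals, i.e. the Borel one.  The minimum is taken in \bar R, where +oo is
   neutral for min: for a nonempty alpha this is min_(a in alpha) |x - a|^2. *)
Definition distortion (R : realType) (P : probability (measurableTypeR R) R)
    (alpha : {fset R}) : \bar R :=
  (\int[P]_x \big[Order.min/+oo]_(a <- alpha) (`|(x : R) - a| ^+ 2)%:E)%E.

Definition codebooks (R : realType) (n : nat) : set {fset R} :=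
  [set alpha : {fset R} | (1 <= #|` alpha| <= n)%N].

Definition quantization_error (R : realType) (n : nat)
    (P : probability (measurableTypeR R) R) : \bar R :=
  ereal_inf [set distortion P alpha | alpha in @codebooks R n].

Definition optimal_set (R : realType) (n : nat)
    (P : probability (measurableTypeR R) R) (alpha : {fset R}) : Prop :=
  @codebooks R n alpha /\ distortion P alpha = quantization_error n P.

(* Av[k, l], both ends included; meaningful for 1 <= k <= l. *)
Definition Av (R : realType) (k l : nat) : R :=
  (\sum_(k <= j < l.+1) j%:R * 2 ^- j) / (\sum_(k <= j < l.+1) 2 ^- j).

(* Av[k, oo), with the sums of the series as limits in R. *)
Definition Av_inf (R : realType) (k : nat) : R :=
  (\big[+%R/0]_(k <= j <oo) (j%:R * 2 ^- j : R)) /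
  (\big[+%R/0]_(k <= j <oo) (2 ^- j : R)).

(* Main.v *)
Require Import Defs.
From mathcomp Require Import all_boot all_order all_algebra finmap.
From mathcomp Require Import all_classical all_reals all_analysis.
From mathcomp Require Import ring lra zify measurable_realfun.
Import Order.TTheory GRing.Theory Num.Theory numFieldNormedType.Exports.
Local Open Scope classical_set_scope.
Local Open Scope ring_scope.

(** For a code a <= b <= c, the points of N served by a, by b and by c are
    {1..m}, {m+1..m+n} and the rest, cut at the midpoints (a+b)/2 and (b+c)/2.
    The terms (j - c)^2 2^-j telescope, so the tail {m+1, ...} costs
    ((m+2-c)^2 + 2) 2^-m >= 2 * 2^-m; the finite blocks are bounded below by
    completing the square around their barycentre.  Blocks as long as {1,2,3}
    already cost more than 1/3, so only finitely many cuts remain, and each of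
    them costs at least 1/3. *)

(** * Geometric series and their telescoping tails *)

(** Beyond the small cases, one step multiplies the cube by at most (5/4)^3 < 2. The bound gives n^2
    2^-n <= 16/(n+1), whence the limits below. *)
Lemma cube_le_exp2 (n : nat) : (n.+1 ^ 3 <= 16 * 2 ^ n)%N.
Proof.
case: n => [|[|[|n]]] //.
elim: n => [//|n IHn]; rewrite [(2 ^ n.+4)%N]expnS mulnCA.
by apply: leq_trans (leq_mul (leqnn 2) IHn); rewrite !expnS !expn0; lia.
Qed.

Section GeometricTails.
Variable R : realType.
Implicit Types (c A B C : R) (u t : nat -> R).

Lemma cvg_sqr_geometric : (n%:R ^+ 2 * 2 ^- n : R) @[n --> \oo] --> (0 : R).
Proof.
apply: (@squeeze_cvgr _ _ _ _ (fun=> 0) (fun n => 16%:R * harmonic n)).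
- near=> n; apply/andP; split; first by rewrite mulr_ge0 // invr_ge0 exprn_ge0.
  rewrite /= ler_pdivlMr ?ltr0n // mulrAC ler_pdivrMr ?exprn_gt0 //.
  rewrite -!natrX -!natrM ler_nat; apply: leq_trans (cube_le_exp2 n).
  by rewrite [(n.+1 ^ 3)%N]expnSr leq_mul2r leq_exp2r // leqnSn orbT.
- exact: cvg_cst.
- have : 16 * @harmonic R n @[n --> \oo] --> 16 * (0 : R).
    by apply: cvgMl_tmp; exact: cvg_harmonic.
  by rewrite mulr0.
Unshelve. all: by end_near.
Qed.

Lemma cvg_quadratic_geometric A B C :
  ((A + B * n%:R + C * n%:R ^+ 2) * 2 ^- n) @[n --> \oo] --> (0 : R).
Proof.
have g0 : (2 ^- n : R) @[n --> \oo] --> (0 : R).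
  under eq_fun do rewrite -exprVn.
  by apply: cvg_expr; rewrite ger0_norm ?invf_lt1 ?ltr1n ?invr_ge0.
have g1 : (n%:R * 2 ^- n : R) @[n --> \oo] --> (0 : R).
  apply: (squeeze_cvgr _ (cvg_cst _) cvg_sqr_geometric); near=> n.
  rewrite mulr_ge0 ?invr_ge0 ?exprn_ge0 //= ler_pM2r ?invr_gt0 ?exprn_gt0 //.
  by rewrite -natrX ler_nat; case: (n) => // k; rewrite expnS expn1 leq_pmulr.
suff: (A * 2 ^- n + B * (n%:R * 2 ^- n) + C * (n%:R ^+ 2 * 2 ^- n)) @[n --> \oo]
    --> A * 0 + B * 0 + C * 0.
  rewrite !mulr0 !addr0; apply: cvg_trans; apply: near_eq_cvg.
  by near=> n; ring.
apply: cvgD; first apply: cvgD.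
- exact: cvgMl_tmp.
- exact: cvgMl_tmp.
- by apply: cvgMl_tmp; exact: cvg_sqr_geometric.
Unshelve. all: by end_near.
Qed.

Lemma sum_telescope u t m n : (m <= n)%N ->
  (forall k, t k = u k - u k.+1) -> \sum_(m <= k < n) t k = u m - u n.
Proof.
move=> mn tE; rewrite -opprB -telescope_sumr // -sumrN.
by apply: eq_bigr => k _; rewrite tE opprB.
Qed.

Lemma lim_telescope u t m : u n @[n --> \oo] --> (0 : R) ->
  (forall k, t k = u k - u k.+1) -> \big[+%R/0]_(m <= k <oo) t k = u m.
Proof.
move=> u0 tE; apply: cvg_lim => //.
apply: (@cvg_trans _ ((u m - u n) @[n --> \oo])).
  apply: near_eq_cvg; near=> n; rewrite (@sum_telescope u) //.
  by near: n; exact: nbhs_infty_ge.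
suff: (u m - u n) @[n --> \oo] --> u m - 0 by rewrite subr0.
by apply: cvgB => //; exact: cvg_cst.
Unshelve. all: by end_near.
Qed.

(** Both series telescope, with remainders 2 * 2^-j and (j+1) * 2 * 2^-j, so the numerator is k+1
    times the denominator. *)
Lemma Av_infE k : Av_inf R k = k.+1%:R.
Proof.
have s0 : \big[+%R/0]_(k <= j <oo) (2 ^- j : R) = 2 * 2 ^- k.
  apply: (@lim_telescope (fun j => 2 * 2 ^- j)) => [|j].
    have := cvg_quadratic_geometric 2 0 0.
    by under eq_fun do rewrite !mul0r !addr0.
  by rewrite exprS invfM; field; rewrite expf_neq0.
have s1 : \big[+%R/0]_(k <= j <oo) (j%:R * 2 ^- j : R) = k.+1%:R * (2 * 2 ^- k).
  apply: (@lim_telescope (fun j => j.+1%:R * (2 * 2 ^- j))) => [|j].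
    have := cvg_quadratic_geometric 2 2 0.
    apply: cvg_trans; apply: near_eq_cvg; near=> n.
    by rewrite -natr1; ring.
  by rewrite exprS invfM -!natr1; field; rewrite expf_neq0.
by rewrite /Av_inf s0 s1 mulfK // mulf_neq0 // invr_neq0 // expf_neq0.
Unshelve. all: by end_near.
Qed.

(* The squared error sum_(j > m) (j - c)^2 2^-j of serving the tail by c. *)
Definition tail m c : R := ((m.+2%:R - c) ^+ 2 + 2) * 2 ^- m.

(** Equality holds at c = m+2, the barycentre of the tail. The geometric law has variance 2 and the
    tail has mass 2^-m. *)
Lemma tail_ge m c : 2 * 2 ^- m <= tail m c.
Proof. by rewrite ler_pM2r ?invr_gt0 ?exprn_gt0 // lerDr sqr_ge0. Qed.

(** With y = k+1-c this is y^2 = 2((y+1)^2 + 2) - ((y+2)^2 + 2), scaled by 2^-(k+1). *)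
Lemma tail_telescope c k : (k.+1%:R - c) ^+ 2 * 2 ^- k.+1 = tail k c - tail k.+1 c.
Proof.
by rewrite /tail [2 ^+ k.+1]exprS invfM -!natr1; field; rewrite expf_neq0.
Qed.

Lemma cvg_tail c : tail m c @[m --> \oo] --> (0 : R).
Proof.
have := cvg_quadratic_geometric ((2 - c) ^+ 2 + 2) (2 * (2 - c)) 1.
apply: cvg_trans; apply: near_eq_cvg; near=> n.
by rewrite /tail -!natr1; ring.
Unshelve. all: by end_near.
Qed.

End GeometricTails.

Arguments tail {R}.

(** * From the integral to a weighted series *)

(** Passes from finite partial sums, which miss the target by a vanishing remainder [v n], to the
    full bound; [x] may be infinite. *)
Lemma lee_cvg0 (R : realType) (v : nat -> R) (a : R) (x : \bar R) m :
  v n @[n --> \oo] --> (0 : R) ->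
  (forall n, (m <= n)%N -> ((a - v n)%:E <= x)%E) -> (a%:E <= x)%E.
Proof.
move=> v0 ax.
have a_v : (a - v n) @[n --> \oo] --> a.
  suff: (a - v n) @[n --> \oo] --> a - 0 by rewrite subr0.
  by apply: cvgB => //; exact: cvg_cst.
case: x ax => [r|_|/(_ _ (leqnn m)) //]; last exact: leey.
move=> ar; rewrite lee_fin; apply: (cvgr_to_le a_v); near=> n.
by rewrite -lee_fin ar //; near: n; exact: nbhs_infty_ge.
Unshelve. all: by end_near.
Qed.

Section Distortion.
Variables (R : realType) (P : probability (measurableTypeR R) R).
Hypothesis hP : forall k : nat, (1 <= k)%N -> P [set k%:R] = (2 ^- k)%:E.
Implicit Types (alpha : {fset R}) (h : nat -> R) (m k : nat) (a c x : R).

(* The argument lives in measurableTypeR R so that integrals over P typecheck. *)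
Definition err alpha (x : measurableTypeR R) : \bar R :=
  \big[Order.min/+oo%E]_(a <- alpha) (`|(x : R) - a| ^+ 2)%:E.

Lemma err_ge0 alpha x : (0 <= err alpha x)%E.
Proof. by apply: le_bigmin => // a _; rewrite lee_fin exprn_ge0. Qed.

Lemma measurable_err alpha : measurable_fun setT (err alpha).
Proof.
rewrite /err; elim: (enum_fset alpha) => [|a s IHs].
  by under eq_fun do rewrite big_nil; exact: measurable_cst.
under eq_fun do rewrite big_cons.
apply: measurable_mine => //.
apply/measurable_EFinP; apply: measurable_funX.
apply: measurableT_comp => //; exact: measurable_funB.
Qed.

Lemma le_err alpha x y : (forall a, a \in alpha -> y <= (x - a) ^+ 2) ->
  (y%:E <= err alpha x)%E.
Proof.
move=> yle; rewrite /err big_seq; apply: le_bigmin => [|a /yle]; first exact: leey.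
by rewrite lee_fin real_normK ?num_real.
Qed.

Lemma err_le alpha x a : a \in alpha -> (err alpha x <= ((x - a) ^+ 2)%:E)%E.
Proof.
rewrite /err; have -> : (a \in alpha) = (a \in enum_fset alpha) by [].
elim: (enum_fset alpha) => [//|b s IHs]; rewrite inE big_cons ge_min.
case/predU1P => [<-|/IHs ->]; last by rewrite orbT.
by rewrite lee_fin real_normK ?num_real ?lexx.
Qed.

Definition atoms : set (measurableTypeR R) := \bigcup_k [set k.+1%:R].

Lemma trivIset_atoms : trivIset setT (fun k => [set k.+1%:R : R]).
Proof. by move=> i j _ _ [x [/= -> /eqP]]; rewrite eqr_nat => /eqP []. Qed.

Lemma measurable_atoms : measurable atoms.
Proof. by apply: bigcup_measurable => k _; exact: measurable_set1. Qed.

(** The first n atoms have mass 1 - 2^-n, so the complement of [atoms] is null and the integral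
    reduces to a series. *)
Lemma probability_atoms : P atoms = 1%E.
Proof.
apply/eqP; rewrite eq_le probability_le1 /=; last exact: measurable_atoms.
apply: (@lee_cvg0 _ (fun n => 2 ^- n) _ _ 0).
  have := @cvg_quadratic_geometric R 1 0 0.
  by under eq_fun do rewrite !mul0r !addr0 mul1r.
move=> n _; rewrite measure_semi_bigcup //; [|exact: trivIset_atoms|exact: measurable_atoms].
apply: le_trans (nneseries_lim_ge n _) => //=.
rewrite (eq_bigr (fun k => (2 ^- k.+1)%:E)) => [|k _]; last exact: hP.
rewrite sumEFin lee_fin (@sum_telescope _ (fun k => 2 ^- k)) ?expr0 ?invr1 // => k.
by rewrite exprS invfM; field; rewrite expf_neq0.
Qed.

Lemma distortionE alpha :
  distortion P alpha = (\sum_(0 <= k <oo) err alpha k.+1%:R * (2 ^- k.+1)%:E)%E.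
Proof.
rewrite /distortion (@ge0_negligible_integral _ _ _ P setT (~` atoms)) //.
- rewrite setTD setCK ge0_integral_bigcup //.
  + apply: eq_eseriesr => k _.
    rewrite (eq_integral (cst (err alpha k.+1%:R))); last by move=> x; rewrite inE => ->.
    rewrite integral_cst //; congr (_ * _)%E; exact: hP.
  + exact: measurable_funS (measurable_err alpha).
  + by move=> x _; exact: err_ge0.
  + exact: trivIset_atoms.
- by apply: measurableC; exact: measurable_atoms.
- exact: measurable_err.
- by move=> x _; exact: err_ge0.
- have := probability_setC P measurable_atoms.
  by rewrite probability_atoms subee.
Qed.

Lemma sum_le_distortion alpha h m :
  (forall k, (k < m)%N -> ((h k)%:E <= err alpha k.+1%:R)%E) ->
  ((\sum_(0 <= k < m) h k * 2 ^- k.+1)%:E <= distortion P alpha)%E.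
Proof.
move=> hle; rewrite distortionE.
apply: (@le_trans _ _ (\sum_(0 <= k < m) err alpha k.+1%:R * (2 ^- k.+1)%:E)%E).
  rewrite -sumEFin !big_mkord; apply: lee_sum => k _.
  by rewrite EFinM lee_pmul2r ?hle // lte_fin invr_gt0 exprn_gt0.
apply: nneseries_lim_ge => k _ _.
by rewrite mule_ge0 ?err_ge0 // lee_fin invr_ge0 exprn_ge0.
Qed.

Lemma distortion_ge alpha h m c :
  (forall k, (k < m)%N -> ((h k)%:E <= err alpha k.+1%:R)%E) ->
  (forall k, (m <= k)%N -> (((k.+1%:R - c) ^+ 2)%:E <= err alpha k.+1%:R)%E) ->
  ((\sum_(0 <= k < m) h k * 2 ^- k.+1 + tail m c)%:E <= distortion P alpha)%E.
Proof.
move=> hle cle; apply: (lee_cvg0 _ (tail ^~ c) _ _ m) => [|n mn]; first exact: cvg_tail.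
(* For n >= m, [tail m c - tail n c] is the sum over m <= k < n. Gluing it to the first m terms
   through [g] leaves one finite sum to bound. *)
pose g k := if (k < m)%N then h k else (k.+1%:R - c) ^+ 2.
rewrite -addrA -(@sum_telescope _ (tail ^~ c) _ _ _ mn (tail_telescope _ c)).
rewrite [X in (X + _)%:E](eq_big_nat _ _ (F2 := fun k => g k * 2 ^- k.+1)); last first.
  by move=> k /andP[_ km]; rewrite /g km.
rewrite [X in (_ + X)%:E](eq_big_nat _ _ (F2 := fun k => g k * 2 ^- k.+1)); last first.
  by move=> k /andP[mk _]; rewrite /g ltnNge mk.
rewrite -big_cat_nat //=; apply: sum_le_distortion => k _; rewrite /g.
by case: ltnP => [/hle|/cle].
Qed.

Lemma distortion_le alpha h m c :
  (forall k, (k < m)%N -> (err alpha k.+1%:R <= (h k)%:E)%E) ->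
  (forall k, (m <= k)%N -> (err alpha k.+1%:R <= ((k.+1%:R - c) ^+ 2)%:E)%E) ->
  (distortion P alpha <= (\sum_(0 <= k < m) h k * 2 ^- k.+1 + tail m c)%:E)%E.
Proof.
move=> hle cle; pose w k : R := 2 ^- k.+1.
have w_ge0 k : (0 <= (w k)%:E)%E by rewrite lee_fin invr_ge0 exprn_ge0.
rewrite distortionE; apply: lime_le.
  by apply: is_cvg_nneseries => k _ _; rewrite mule_ge0 ?err_ge0.
near=> n; have mn : (m <= n)%N by near: n; exact: nbhs_infty_ge.
rewrite (@big_cat_nat _ _ _ m) //= EFinD leeD //.
  rewrite -sumEFin !big_mkord; apply: lee_sum => k _.
  by rewrite EFinM lee_wpmul2r ?hle.
apply: (@le_trans _ _ (\sum_(m <= k < n) ((k.+1%:R - c) ^+ 2 * w k)%:E)%E).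
  rewrite !big_nat; apply: lee_sum => k /andP[mk _].
  by rewrite EFinM lee_wpmul2r ?cle.
(* The block sums to [tail m c - tail n c], and the subtracted remainder is nonnegative. *)
rewrite sumEFin lee_fin (@sum_telescope _ (tail ^~ c)) //; last exact: tail_telescope.
by rewrite gerBl (le_trans _ (tail_ge _ _ _)) // mulr_ge0 // invr_ge0 exprn_ge0.
Unshelve. all: by end_near.
Qed.

End Distortion.

(** * Lower bound 1/3 for every code of at most three points *)

Section ThreeMeans.
Variables (R : realType) (P : probability (measurableTypeR R) R).
Hypothesis hP : forall k : nat, (1 <= k)%N -> P [set k%:R] = (2 ^- k)%:E.
Implicit Types (alpha : {fset R}) (m n k : nat) (a b c x y : R).

(** Codes with one or two points are padded by repetition, so a single sorted triple covers all
    cardinalities. *)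
Lemma codebook3_sorted alpha : @codebooks R 3 alpha -> exists a b c,
  [/\ a <= b, b <= c & forall e, e \in alpha -> [\/ e = a, e = b | e = c]].
Proof.
pose s := sort <=%R (enum_fset alpha).
have s_in e : (e \in alpha) = (e \in s) by rewrite mem_sort.
have : sorted <=%R s by exact: sort_le_sorted.
rewrite /codebooks /= -(size_sort <=%R) -/s.
case: s s_in => [|a [|b [|c [|d s]]]] //= s_in; rewrite ?andbT.
- by exists a, a, a; split=> // e; rewrite s_in inE => /eqP; constructor.
- move=> ab _; exists a, a, b; split=> // e.
  by rewrite s_in !inE => /orP[] /eqP; [constructor 1|constructor 3].
- move=> /andP[ab bc] _; exists a, b, c; split=> // e.
  by rewrite s_in !inE => /or3P[] /eqP; [constructor 1|constructor 2|constructor 3].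
Qed.

Variables (alpha : {fset R}) (a b c : R).
Hypotheses (ab : a <= b) (bc : b <= c).
Hypothesis alphaE : forall e, e \in alpha -> [\/ e = a, e = b | e = c].

(* Indexed so that k stands for the point k.+1 of the support. *)
Definition voronoi m n k : R :=
  if (k < m)%N then a else if (k < m + n)%N then b else c.

Lemma sqr_dist_lel x u v : u <= v -> x <= (u + v) / 2 -> (x - u) ^+ 2 <= (x - v) ^+ 2.
Proof.
move=> uv xuv; rewrite -subr_ge0 (_ : _ - _ = (v - u) * (u + v - 2 * x)); last by ring.
by apply: mulr_ge0; lra.
Qed.

Lemma sqr_dist_ler x u v : u <= v -> (u + v) / 2 <= x -> (x - v) ^+ 2 <= (x - u) ^+ 2.
Proof.
move=> uv uvx; rewrite -subr_ge0 (_ : _ - _ = (v - u) * (2 * x - (u + v))); last by ring.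
by apply: mulr_ge0; lra.
Qed.

Lemma err_ge_fst x : x <= (a + b) / 2 -> (((x - a) ^+ 2)%:E <= err R alpha x)%E.
Proof.
move=> xab; have ac := le_trans ab bc; have xac : x <= (a + c) / 2 by move: ab bc; lra.
by apply: le_err => e /alphaE[] -> //; apply: sqr_dist_lel.
Qed.

Lemma err_ge_snd x : (a + b) / 2 <= x -> x <= (b + c) / 2 ->
  (((x - b) ^+ 2)%:E <= err R alpha x)%E.
Proof.
move=> abx xbc; apply: le_err => e /alphaE[] -> //; first exact: sqr_dist_ler.
exact: sqr_dist_lel.
Qed.

Lemma err_ge_trd x : (b + c) / 2 <= x -> (((x - c) ^+ 2)%:E <= err R alpha x)%E.
Proof.
move=> bcx; have ac := le_trans ab bc; have acx : (a + c) / 2 <= x by move: ab bc; lra.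
by apply: le_err => e /alphaE[] -> //; apply: sqr_dist_ler.
Qed.

(** It suffices to test the midpoints against the extreme points of each block. The guards let a
    block be empty, and the cut before c matters only for points beyond m+n. *)
Lemma voronoi_err m n k :
  ((0 < m)%N -> m%:R <= (a + b) / 2) ->
  ((0 < n)%N -> (a + b) / 2 <= m.+1%:R /\ (m + n)%:R <= (b + c) / 2) ->
  (k < m + n)%N \/ (b + c) / 2 <= (m + n).+1%:R ->
  (((k.+1%:R - voronoi m n k) ^+ 2)%:E <= err R alpha k.+1%:R)%E.
Proof.
move=> am bn; rewrite /voronoi; have [km|mk] := ltnP k m.
  move=> _; apply: err_ge_fst; apply: le_trans (am (leq_ltn_trans (leq0n k) km)).
  by rewrite ler_nat.
have [kmn|mnk] := ltnP k (m + n) => [_|[//|bmn]].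
  have n0 : (0 < n)%N by move: mk kmn; lia.
  have [{}am {}bn] := bn n0.
  by apply: err_ge_snd; [apply: le_trans am _|apply: le_trans bn]; rewrite ler_nat.
by apply: err_ge_trd; apply: le_trans bmn _; rewrite ler_nat.
Qed.

(** Discards everything beyond m+n, so no upper bound on (b+c)/2 is required; it settles the cases
    where a block is long. *)
Lemma voronoi_sum_le m n :
  ((0 < m)%N -> m%:R <= (a + b) / 2) ->
  ((0 < n)%N -> (a + b) / 2 <= m.+1%:R /\ (m + n)%:R <= (b + c) / 2) ->
  ((\sum_(0 <= k < m + n) (k.+1%:R - voronoi m n k) ^+ 2 * 2 ^- k.+1)%:E
    <= distortion P alpha)%E.
Proof.
by move=> am bn; apply: sum_le_distortion => // k kmn; apply: voronoi_err => //; left.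
Qed.

Lemma voronoi_tail_le m n :
  ((0 < m)%N -> m%:R <= (a + b) / 2) ->
  ((0 < n)%N -> (a + b) / 2 <= m.+1%:R /\ (m + n)%:R <= (b + c) / 2) ->
  (b + c) / 2 <= (m + n).+1%:R ->
  ((\sum_(0 <= k < m + n) (k.+1%:R - voronoi m n k) ^+ 2 * 2 ^- k.+1 + 2 * 2 ^- (m + n))%:E
    <= distortion P alpha)%E.
Proof.
move=> am bn cmn.
apply: (@le_trans _ _ (\sum_(0 <= k < m + n) (k.+1%:R - voronoi m n k) ^+ 2 * 2 ^- k.+1
    + tail (m + n) c)%:E); first by rewrite lee_fin lerD2l tail_ge.
apply: distortion_ge => // k kmn.
  by apply: voronoi_err => //; left.
by apply: err_ge_trd; apply: le_trans cmn _; rewrite ler_nat.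
Qed.


(** The midpoints p and q are located among the integers. The bound obtained equals 1/3 in two cases
    only, those with blocks {1}, {2,3} and {1,2}, {3,4}, which match the two optimal sets. *)
Lemma third_le_distortion : ((3^-1)%:E <= distortion P alpha)%E.
Proof.
pose p := (a + b) / 2; pose q := (b + c) / 2.
have pq : p <= q by rewrite ler_pM2r ?invr_gt0 ?ltr0n //; move: ab bc; lra.
have [p3|/ltW p3] := leP 3 p.
  apply: (le_trans _ (@voronoi_sum_le 3 0 _ _)) => //.
  rewrite lee_fin /index_iota /= !big_cons big_nil /voronoi /=.
  (* 11/7 is the barycentre of {1,2,3}, whose cost is at least 13/28. Each hint below likewise
     centres its square at the barycentre of the block served. *)
  have := sqr_ge0 (a - 11/7); nra.
(* If q < 3, then c serves every point from 3 on, and that tail alone costs at least 2 * 2^-2 =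
   1/2. *)
have [q3|q3] := ltP q 3.
  have := @distortion_ge _ _ hP alpha (fun=> 0) 2 c.
  rewrite big1 ?add0r => [|k _]; last by rewrite mul0r.
  move=> h; apply: (le_trans _ (h _ _)) => [|k _|k k2].
  - by rewrite lee_fin; apply: le_trans (tail_ge _ _ _); lra.
  - exact: err_ge0.
  - by apply: err_ge_trd; apply: le_trans (ltW q3) _; rewrite ler_nat.
have [/ltW p1|p1] := ltP p 1.
  apply: (le_trans _ (@voronoi_sum_le 0 3 _ _)) => //.
  rewrite lee_fin /index_iota /= !big_cons big_nil /voronoi /=.
  have := sqr_ge0 (b - 11/7); nra.
(* Now a serves 1 alone. With b serving {2,..,5}, {2,3,4} or {2,3}, the bounds are 97/240 (no tail),
   13/56 + 1/8 and 1/12 + 1/4 = 1/3. *)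
have [/ltW p2|p2] := ltP p 2.
  have [q5|/ltW q5] := leP 5 q.
    apply: (le_trans _ (@voronoi_sum_le 1 4 _ _)) => //.
    rewrite lee_fin /index_iota /= !big_cons big_nil /voronoi /=.
    have := sqr_ge0 (a - 1); have := sqr_ge0 (b - 41/15); nra.
  have [q4|/ltW q4] := leP 4 q.
    apply: (le_trans _ (@voronoi_tail_le 1 3 _ _ _)) => //.
    rewrite lee_fin /index_iota /= !big_cons big_nil /voronoi /=.
    have := sqr_ge0 (a - 1); have := sqr_ge0 (b - 18/7); nra.
  apply: (le_trans _ (@voronoi_tail_le 1 2 _ _ _)) => //.
  rewrite lee_fin /index_iota /= !big_cons big_nil /voronoi /=.
  have := sqr_ge0 (a - 1); have := sqr_ge0 (b - 7/3); nra.
(* Now a serves {1,2} at cost at least 1/6. With b serving {3,..,6}, {3,4,5}, {3,4} or {3}, the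
   totals are 59/160 (no tail), 29/84, 1/3 and 5/12. *)
have [q6|/ltW q6] := leP 6 q.
  apply: (le_trans _ (@voronoi_sum_le 2 4 _ _)) => //.
  rewrite lee_fin /index_iota /= !big_cons big_nil /voronoi /=.
  have := sqr_ge0 (a - 4/3); have := sqr_ge0 (b - 56/15); nra.
have [q5|/ltW q5] := leP 5 q.
  apply: (le_trans _ (@voronoi_tail_le 2 3 _ _ _)) => //.
  rewrite lee_fin /index_iota /= !big_cons big_nil /voronoi /=.
  have := sqr_ge0 (a - 4/3); have := sqr_ge0 (b - 25/7); nra.
have [q4|/ltW q4] := leP 4 q.
  apply: (le_trans _ (@voronoi_tail_le 2 2 _ _ _)) => //.
  rewrite lee_fin /index_iota /= !big_cons big_nil /voronoi /=.
  have := sqr_ge0 (a - 4/3); have := sqr_ge0 (b - 10/3); nra.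
apply: (le_trans _ (@voronoi_tail_le 2 1 _ _ _)) => //.
rewrite lee_fin /index_iota /= !big_cons big_nil /voronoi /=.
have := sqr_ge0 (a - 4/3); have := sqr_ge0 (b - 3); nra.
Qed.

End ThreeMeans.

(** * The two optimal codes *)

Lemma codebooks_fset3 (R : realType) (x y z : R) :
  @codebooks R 3 [fset x; y; z]%fset.
Proof.
rewrite /codebooks /= cardfs_gt0; apply/andP; split.
  by apply/fset0Pn; exists x; rewrite !inE eqxx.
apply: leq_trans (leq_card_fsetU _ _) _; rewrite cardfs1 addn1 ltnS.
by apply: leq_trans (leq_card_fsetU _ _) _; rewrite !cardfs1.
Qed.

Theorem proposition4p12 (R : realType) (P : probability (measurableTypeR R) R)
    (hP : forall k : nat, (1 <= k)%N -> P [set k%:R] = (2 ^- k)%:E) :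
  let alpha : {fset R} := [fset 1; Av R 2 3; Av_inf R 4]%fset in
  let beta : {fset R} := [fset Av R 1 2; Av R 3 4; Av_inf R 5]%fset in
  [/\ alpha <> beta,
      optimal_set 3 P alpha,
      optimal_set 3 P beta
    & quantization_error 3 P = (3^-1)%:E].
Proof.
move=> alpha beta.
have Av23 : Av R 2 3 = 7 / 3 by rewrite /Av /index_iota /= !big_cons !big_nil; field.
have Av12 : Av R 1 2 = 4 / 3 by rewrite /Av /index_iota /= !big_cons !big_nil; field.
have Av34 : Av R 3 4 = 10 / 3 by rewrite /Av /index_iota /= !big_cons !big_nil; field.
have third_le gamma : @codebooks R 3 gamma -> ((3^-1)%:E <= distortion P gamma)%E.
  move=> /codebook3_sorted[a [b [c [ab bc gammaE]]]].
  exact: third_le_distortion ab bc gammaE.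
have alpha3 : @codebooks R 3 alpha by exact: codebooks_fset3.
have beta3 : @codebooks R 3 beta by exact: codebooks_fset3.
have distalpha : distortion P alpha = (3^-1)%:E.
  apply/eqP; rewrite eq_le third_le // andbT.
  (* Index k stands for the point k+1. The block {2,3} costs 1/12 and the tail from 4, served by its
     barycentre 5, costs 1/4. *)
  pose h := nth (0 : R) [:: 0; (2 - 7 / 3) ^+ 2; (3 - 7 / 3) ^+ 2].
  apply: (le_trans (@distortion_le _ _ hP alpha h 3 5 _ _)).
  - case=> [|[|[|//]]] _; rewrite /h /=.
    + rewrite [X in X%:E](_ : 0 = (1 - 1) ^+ 2); last by rewrite subrr expr0n.
      by apply: err_le; rewrite !inE eqxx.
    + by apply: err_le; rewrite !inE Av23 eqxx orbT.
    + by apply: err_le; rewrite !inE Av23 eqxx orbT.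
  - by move=> k _; apply: err_le; rewrite !inE Av_infE eqxx orbT.
  - rewrite lee_fin /index_iota /= !big_cons big_nil /h /tail /=; lra.
have distbeta : distortion P beta = (3^-1)%:E.
  apply/eqP; rewrite eq_le third_le // andbT.
  (* The blocks {1,2} and {3,4} cost 1/6 and 1/24; the tail from 5, served by 6, costs 1/8. *)
  pose h := nth (0 : R)
    [:: (1 - 4 / 3) ^+ 2; (2 - 4 / 3) ^+ 2; (3 - 10 / 3) ^+ 2; (4 - 10 / 3) ^+ 2].
  apply: (le_trans (@distortion_le _ _ hP beta h 4 6 _ _)).
  - case=> [|[|[|[|//]]]] _; rewrite /h /=; apply: err_le;
      by rewrite !inE ?Av12 ?Av34 eqxx ?orbT.
  - by move=> k _; apply: err_le; rewrite !inE Av_infE eqxx orbT.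
  - rewrite lee_fin /index_iota /= !big_cons big_nil /h /tail /=; lra.
have quant : quantization_error 3 P = (3^-1)%:E.
  apply/eqP; rewrite eq_le; apply/andP; split.
    by apply: ereal_inf_lbound; exists alpha.
  by apply: le_ereal_inf_tmp => _ [gamma gamma3 <-]; exact: third_le.
split=> //.
(* The point 1 separates the two sets: the members of [beta] are 4/3, 10/3 and 6. *)
- move=> /fsetP /(_ 1); rewrite !inE eqxx /= Av12 Av34 Av_infE.
  by move=> /esym /orP[/orP[]|] /eqP; lra.
- by split=> //; rewrite quant.
- by split=> //; rewrite quant.
Qed.
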